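(* Let $P=\mathsf{k}[x_1,\dots,x_n]$ be a standard graded polynomial ring over a field $\mathsf{k}$, and let $I\subseteq P$ be a quadratic monomial ideal that admits linear quotients, with linear quotient ordering $m_1,\dots,m_r$ of its minimal monomial generators. For each integer $k\ge 1$ let $\widetilde{\mathcal{R}^k}$ be the ordered list of monomials obtained from $m_1,\dots,m_r$ by ordering all formal products of $k$ of the $m_i$ in the reverse lexicographic order of their exponent vectors and deleting repetitions, as defined in the context. Then for every integer $k\ge 1$, $\widetilde{\mathcal{R}^k}$ is a linear quotient ordering of $I^k$.
   Context: A quadratic monomial ideal is an ideal generated by monomials of degree 2 (squares $x_i^2$ are allowed). An ordering $m_1,\dots,m_r$ of a minimal set of generators of an ideal $I\subseteq P$ is a linear quotient ordering of $I$ if for each $i=2,\dots,r$ the ideal quotient $(m_1,\dots,m_{i-1}):(m_i)$ is generated by some subset of the variables $x_1,\dots,x_n$. The ideal $I$ has (admits) linear quotients if such an ordering of a minimal generating set exists; for monomial ideals the minimal generators are taken to be the minimal monomial generators. Construction of $\widetilde{\mathcal{R}^k}$. Fix the linear quotient ordering $m_1,\dots,m_r$ of $I$ and $k\ge 1$. Consider the $\binom{r+k-1}{k}$ formal products $m_1^{\alpha_1}\cdots m_r^{\alpha_r}$ with $\alpha_i\in\mathbb{Z}_{\ge 0}$ and $\alpha_1+\dots+\alpha_r=k$. Let $\mathcal{R}^k$ be the list of all of these formal products, ordered as follows: $m_1^{\alpha_1}\cdots m_r^{\alpha_r}$ precedes $m_1^{\beta_1}\cdots m_r^{\beta_r}$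 if and only if there is $i\in\{1,\dots,r\}$ with $\alpha_j=\beta_j$ for all $j>i$ and $\alpha_i<\beta_i$ (i.e. the last nonzero entry of $\alpha-\beta$ is negative). Different formal products may be equal as monomials in $P$. An entry $M$ of $\mathcal{R}^k$ is called a representative if no entry $M'$ preceding $M$ in $\mathcal{R}^k$ is equal to $M$ as an element of $P$. The list $\widetilde{\mathcal{R}^k}$ is obtained from $\mathcal{R}^k$ by removing all entries that are not representatives and keeping the order; its entries, viewed as monomials in $P$, form the minimal monomial generating set of $I^k$. *)

(* Defs.v *)
From mathcomp Require Import all_boot all_order all_algebra.
From mathcomp.multinomials Require Import mpoly.

Set Implicit Arguments.
Unset Strict Implicit.
Unset Printing Implicit Defensive.

Import GRing.Theory.
Local Open Scope ring_scope.

(* Subsets of a ring, in particular ideals, are Prop-valued predicates: the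
   boolean ideals of ring_quotient are decidable and proper, which would
   exclude the unit ideal. *)
Definition same_set (T : Type) (A B : T -> Prop) : Prop :=
  forall x, A x <-> B x.

Section Ideals.
Variable R : comNzRingType.
Implicit Types (S I J : R -> Prop) (s : seq R).

Definition ideal_gen S : R -> Prop := fun p =>
  exists c : seq (R * R),
    (forall x, x \in c -> S x.2) /\ p = \sum_(x <- c) x.1 * x.2.

Definition ideal_seq s : R -> Prop := ideal_gen (fun p => p \in s).

Definition ideal_colon I J : R -> Prop := fun f => forall g, J g -> I (f * g).

Definition ideal_pow I (k : nat) : R -> Prop :=
  ideal_gen (fun p =>
    exists f : 'I_k -> R, (forall i, I (f i)) /\ p = \prod_(i < k) f i).

Definition minimal_generators I s : Prop :=
  [/\ uniq s,
      same_set I (ideal_seq s)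
    & forall t : seq R, {subset t <= s} -> same_set I (ideal_seq t) ->
        {subset s <= t}].

End Ideals.

Section LinearQuotients.
Variables (K : fieldType) (n : nat).
Local Notation P := {mpoly K[n]}.

Definition quadratic_monomial_ideal (I : P -> Prop) : Prop :=
  exists T : 'X_{1..n} -> Prop,
    (forall u, T u -> mdeg u = 2%N) /\
    same_set I (ideal_gen (fun p : P => exists2 u, T u & p = 'X_[u])).

Definition generated_by_variables (I : P -> Prop) : Prop :=
  exists A : {set 'I_n},
    same_set I (ideal_gen (fun p : P => exists2 j, j \in A & p = 'X_j)).

(* Entries are indexed from 0, so i = 1, ..., size s - 1 below. *)
Definition linear_quotient_ordering (I : P -> Prop) (s : seq P) : Prop :=
  minimal_generators I s /\
  forall i : nat, (0 < i < size s)%N ->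
    generated_by_variables
      (ideal_colon (ideal_seq (take i s)) (ideal_seq [:: s`_i])).

End LinearQuotients.

(* The formal product g_1^a_1 ... g_r^a_r is encoded by its exponent vector
   a : 'X_{1..r}. *)
Section FormalProducts.
Variables (R : comNzRingType) (r : nat) (g : 'I_r -> R) (k : nat).

Definition precedes (a b : 'X_{1..r}) : bool :=
  [exists i : 'I_r,
    [forall j : 'I_r, (i < j)%N ==> (a j == b j)] && (a i < b i)%N].

Definition formal_products : seq 'X_{1..r} :=
  sort (fun a b => (a == b) || precedes a b)
    [seq a <- [seq bmnm b | b <- enum {: 'X_{1..r < k.+1}}] | mdeg a == k].

Definition product_value (a : 'X_{1..r}) : R := \prod_(i < r) g i ^+ a i.

Definition representative (a : 'X_{1..r}) : bool :=
  all (fun b => precedes b a ==> (product_value b != product_value a))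
    formal_products.

Definition reduced_products : seq R :=
  [seq product_value a | a <- formal_products & representative a].

End FormalProducts.

(* Main.v *)
Require Import Defs.
From mathcomp Require Import all_boot all_order all_algebra zify.
From mathcomp.multinomials Require Import mpoly.

(** Why powers inherit linear quotients.

    A monomial ideal is known from the exponents of its monomials, so a list of
    distinct monomials generating the ideal is a linear quotient ordering
    exactly when its entries are pairwise indivisible and, for every [v] listed before [u], some [v']
    listed before [u] divides [u * x_p] for a variable [x_p] whose exponent is
    larger in [v] than in [u] ([linear_quotient_orderingP]).  All the entries
    for [I^k] have degree [2k], hence are pairwise indivisible, and [I^k] is
    generated by the products of [k] generators ([ideal_pow_monomials]).  What
    remains is combinatorial ([product_exchange]): if [b] precedes [a] and no
    formal product preceding [a] has the value of [a], then some [c] preceding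
    [a] has a value dividing [value(a) * x_p], with [p] a surplus variable,
    that is, one with larger exponent in [value(b)] than in [value(a)].

    See a generator [x_u x_w] as an edge [u - w], a loop if [u = w].  After
    removal of the common factors of [a] and [b], colour the edges of [a] red
    and those of [b] blue.  Let [t] be the last index at which [a] and [b]
    differ: [t] is red and every blue edge has a smaller index.  Hence
    exchanging a set of red edges that contains [t] for edges below [t] always
    gives a product that precedes [a].  Pairing off red and blue edge ends at
    each vertex cuts the coloured multigraph into alternating paths and
    cycles, and the component of [t] is of one of three kinds.
    - A cycle: exchanging its colours gives a product that precedes [a] and
      has the same value, which is excluded.
    - A path with a blue end [p]: then [p] is a surplus variable, and
      exchanging along the path from [p] up to [t] multiplies the value by
      [x_p / x_q] with [q] an end of [t].
    - A path with two red ends: by counting, another component has two blue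
      ends.  The linear quotient property of [I], applied to [t] and the first
      blue edge of that component, joins [t] to this edge by an edge below
      [t].  Removing [t], adding the joining edge and, if it does not reach a
      blue end, exchanging along the rest of the component multiplies the
      value by [x_p / x_q] with [q] an end of [t] and [p] one of the two blue
      ends, which are surplus variables.

    The decomposition is never built.  [exchange] removes the red edges one by
    one instead: a red edge met by blue edges at both ends is contracted with
    them into one virtual blue edge ([chord_contract]), and otherwise it is
    discarded with at most one blue edge, in a way that creates no surplus.  A
    virtual edge records which red edges it has swallowed, and [chord_ok]
    states what the last two kinds of exchange need to know about it. *)

Set Implicit Arguments.
Unset Strict Implicit.
Unset Printing Implicit Defensive.

(** * Alternating exchanges *)

Section Exchange.
Variables (n r : nat) (m : 'I_r -> 'X_{1..n}).

(** The exponent vector of [product_value] when the factors are the monomials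
    with exponents [m i]; see [product_valueX]. *)
Definition mval (a : 'X_{1..r}) : 'X_{1..n} := (\sum_(i < r) m i *+ a i)%MM.

Lemma mvalE a v : mval a v = (\sum_(i < r) m i v * a i)%N.
Proof. by rewrite /mval mnm_sumE; apply: eq_bigr => i _; rewrite mulmnE. Qed.

Lemma mvalD a b : mval (a + b)%MM = (mval a + mval b)%MM.
Proof.
apply/mnmP => v; rewrite mnmDE !mvalE -big_split.
by apply: eq_bigr => i _; rewrite mnmDE mulnDr.
Qed.

Lemma mval0 : mval 0%MM = 0%MM.
Proof.
by apply/mnmP => v; rewrite mvalE mnm0E big1 // => i _; rewrite mnm0E muln0.
Qed.

Lemma mval1 i : mval U_(i)%MM = m i.
Proof.
apply/mnmP => v; rewrite mvalE (bigD1 i) //= mnm1E eqxx muln1 big1 ?addn0 //.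
by move=> j ne_ji; rewrite mnm1E eq_sym (negPf ne_ji) muln0.
Qed.

Variable t : 'I_r.

Definition below (b : 'X_{1..r}) : Prop := forall j : 'I_r, (t <= j)%N -> b j = 0%N.

(** The alternating cycle through [t]: red edges [a], chosen among [R], are
    exchanged together with [t] for the edges [b] without changing the value. *)
Definition closes (R : 'X_{1..r}) : Prop := exists a b,
  [/\ (a <= R)%MM, below b & mval b = (m t + mval a)%MM].

(** Exchanging [t] and red edges among [R] for edges below [t] multiplies the
    value by [x_x / x_q].  The vertex [q] is left free, as only [x] has to be a
    surplus variable. *)
Definition bypass (R : 'X_{1..r}) (x : 'I_n) : Prop := exists a b q,
  [/\ (a <= R)%MM, below b & (mval b + U_(q) = m t + mval a + U_(x))%MM].

Lemma belowD b c : below b -> below c -> below (b + c)%MM.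
Proof. by move=> hb hc j tj; rewrite mnmDE hb // hc. Qed.

Lemma closes_le R R' : (R <= R')%MM -> closes R -> closes R'.
Proof.
by move=> le_RR' [a [b [aR hb e]]]; exists a, b; split=> //; apply: lepm_trans aR _.
Qed.

Lemma bypass_le R R' x : (R <= R')%MM -> bypass R x -> bypass R' x.
Proof.
move=> le_RR' [a [b [q [aR hb e]]]]; exists a, b, q; split=> //.
exact: lepm_trans aR _.
Qed.

(** A virtual blue edge: its two ends, and the multiset of the red edges inside
    the alternating path from one end to the other. *)
Definition chord : Type := ('I_n * 'I_n * 'X_{1..r})%type.

(** The first clause is the alternating path itself, whose blue edges [b]
    outnumber its red edges by one.  The second says that once [t] is
    connected to this path, the connection can be carried to one of the two
    ends; this is how the linear quotient property of the generators is
    transported through contractions. *)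
Definition chord_ok (f : chord) : Prop :=
  (exists2 b, below b & mval b = (mval f.2 + U_(f.1.1) + U_(f.1.2))%MM)
  /\ (bypass f.2 f.1.1 \/ bypass f.2 f.1.2).

Lemma chord_sym p u a : chord_ok (p, u, a) -> chord_ok (u, p, a).
Proof.
case=> [[b hb e]] /= h; split; last by case: h; [right | left].
exists b => //=; rewrite e /=; apply/mnmP => v; rewrite !mnmDE; lia.
Qed.

(** Alternating paths [p ... u] and [w ... z] are glued along the red edge
    [u - w].  For the second clause, if the first path carries [t] to its end
    [u], then exchanging [u - w] and the second path continues it to [z]; if
    it carries [t] to [p], that is already an end of the glued path. *)
Lemma chord_contract p u w z a1 a2 i :
    m i = (U_(u) + U_(w))%MM ->
    chord_ok (p, u, a1) -> chord_ok (w, z, a2) ->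
  chord_ok (p, z, (a1 + a2 + U_(i))%MM).
Proof.
move=> ei [[b1 hb1 /= e1] c1] [[b2 hb2 /= e2] _]; split => /=.
  exists (b1 + b2)%MM; first exact: belowD.
  rewrite !mvalD mval1 e1 e2 ei; apply/mnmP => v; rewrite !mnmDE; lia.
have le1 : (a1 <= a1 + a2 + U_(i))%MM by apply/mnm_lepP => j; rewrite !mnmDE; lia.
case: c1 => [c1 | [a [b [q [aR hb e]]]]]; first by left; apply: bypass_le c1.
right; exists (a + a2 + U_(i))%MM, (b + b2)%MM, q; split.
- by apply/mnm_lepP => j; rewrite !mnmDE; move/mnm_lepP: aR => /(_ j); lia.
- exact: belowD.
rewrite !mvalD mval1 e2 ei; apply/mnmP => v.
by move/mnmP: e => /(_ v); rewrite !mnmDE; lia.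
Qed.

Definition ends (B : seq chord) : 'X_{1..n} :=
  (\sum_(f <- B) (U_(f.1.1) + U_(f.1.2)))%MM.
Definition cost (B : seq chord) : 'X_{1..r} := (\sum_(f <- B) f.2)%MM.

(** A collection of chords matters only through its size, [ends] and [cost], so
    a chord is split off additively in these; reorienting it spares the later
    case distinctions on which of its ends is [u]. *)
Lemma chord_at (B : seq chord) u : {in B, forall f, chord_ok f} -> (0 < ends B u)%N ->
  exists p a B0, [/\ chord_ok (u, p, a), {in B0, forall f, chord_ok f},
    size B = (size B0).+1, ends B = (U_(u) + U_(p) + ends B0)%MM
    & cost B = (a + cost B0)%MM].
Proof.
move=> okB; rewrite /ends mnm_sumE lt0n sum_nat_seq_neq0.
case/hasP => [[[p q] a]] fB; rewrite /= mnmDE !mnm1E => hu.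
pose B0 := rem (p, q, a) B.
have pB : perm_eq B ((p, q, a) :: B0) by apply: perm_to_rem.
have okB0 : {in B0, forall f, chord_ok f} by move=> f /mem_rem; apply: okB.
have okf := okB _ fB.
have [->|ne_pu] := eqVneq u p.
  exists q, a, B0; split=> //; first exact: (perm_size pB).
    by rewrite (perm_big _ pB) big_cons.
  by rewrite /cost (perm_big _ pB) big_cons.
have -> : u = q.
  by apply/eqP; move: hu; rewrite ![_ == u]eq_sym (negPf ne_pu); case: (u == q).
exists p, a, B0; split=> //; first exact: chord_sym.
- exact: (perm_size pB).
- rewrite /ends (perm_big _ pB) big_cons -/(ends B0) /=; apply/mnmP => v; rewrite !mnmDE; lia.
by rewrite /cost (perm_big _ pB) big_cons.
Qed.

Variable e : 'I_r -> 'I_n * 'I_n.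
Hypothesis me : forall i, m i = (U_((e i).1) + U_((e i).2))%MM.

(** Induction on the red edges [s] other than [t].  Surplus, which compares
    [ends B] with the degrees of the red edges, is unchanged by a contraction
    and can only shrink when edges are discarded, so a surplus vertex found
    after a step was one before it.  With no red edge left but [t], any chord
    decides: if it meets [t], exchanging it for [t] closes a cycle or reaches
    its other end; if not, both its ends are surplus and the second clause of
    [chord_ok] applies. *)
Lemma exchange (s : seq 'I_r) (B : seq chord) :
    {in B, forall f, chord_ok f} -> (size s < size B)%N ->
  let R := (cost B + \sum_(i <- s) U_(i))%MM in
  closes R \/
  exists2 x, ((m t + \sum_(i <- s) m i)%MM x < ends B x)%N & bypass R x.
Proof.
elim: s B => [|i s IH] B okB ltB /=; last first.
  (* Discarding [i] creates no surplus when the blue degree lost at every vertex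
     still met by a blue edge is at least the red degree lost there. *)
  have drop (B0 : seq chord) :
      {in B0, forall f, chord_ok f} -> (size s < size B0)%N ->
      (cost B0 <= cost B)%MM ->
      (forall x, (0 < ends B0 x -> ends B0 x + m i x <= ends B x)%N) ->
    let R := (cost B + \sum_(i <- i :: s) U_(i))%MM in
    closes R \/
    exists2 x, ((m t + \sum_(i <- i :: s) m i)%MM x < ends B x)%N & bypass R x.
    move=> okB0 ltB0 leB0 hx /=.
    have leR : (cost B0 + \sum_(i <- s) U_(i) <= cost B + \sum_(i <- i :: s) U_(i))%MM.
      apply/mnm_lepP => j; rewrite big_cons !mnmDE.
      by move/mnm_lepP: leB0 => /(_ j); lia.
    case: (IH B0 okB0 ltB0) => [|[x ltx byx]]; first by left; apply: closes_le leR _.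
    right; exists x; last exact: bypass_le leR _.
    by move: (hx x) ltx; rewrite big_cons !mnmDE; lia.
  have := me i; move: (e i) => [u w] /= ei.
  have [u0|uB] := posnP (ends B u).
    have [w0|wB] := posnP (ends B w).
      apply: (drop B) => //; [exact: ltnW | exact: lepm_refl | move=> x].
      rewrite ei mnmDE !mnm1E.
      by case: (eqVneq u x) u0 => [->|_]; case: (eqVneq w x) w0 => [->|_]; lia.
    have [p [a [B0 [okf okB0 sB eB cB]]]] := chord_at okB wB.
    apply: (drop B0) => //; [by rewrite sB in ltB | by rewrite cB lem_addl | move=> x].
    move: u0; rewrite ei eB !mnmDE !mnm1E.
    by case: (eqVneq u x) => [->|_]; lia.
  have [p [a [B0 [okf okB0 sB eB cB]]]] := chord_at okB uB.
  have [wB0|wB0] := posnP (ends B0 w).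
    apply: (drop B0) => //; [by rewrite sB in ltB | by rewrite cB lem_addl | move=> x].
    rewrite ei eB !mnmDE !mnm1E.
    by case: (eqVneq w x) wB0 => [->|_]; lia.
  have [z [a' [B1 [okg okB1 sB0 eB0 cB0]]]] := chord_at okB0 wB0.
  have okh := chord_contract ei (chord_sym okf) okg.
  pose B' := ((p, z, (a + a' + U_(i))%MM) : chord) :: B1.
  have okB' : {in B', forall f, chord_ok f}.
    by move=> f; rewrite inE => /predU1P[-> //|]; apply: okB1.
  have eB' : ends B = (m i + ends B')%MM.
    rewrite eB eB0 ei /ends big_cons -/(ends B1) /=; apply/mnmP => v; rewrite !mnmDE; lia.
  have cB' : (cost B + U_(i) = cost B')%MM.
    by rewrite cB cB0 /cost big_cons -/(cost B1) /=; apply/mnmP => v; rewrite !mnmDE; lia.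
  have -> : (cost B + \sum_(i <- i :: s) U_(i) = cost B' + \sum_(i <- s) U_(i))%MM.
    by rewrite -cB' big_cons; apply/mnmP => v; rewrite !mnmDE; lia.
  case: (IH B' okB') => [|cl|[x ltx byx]]; first by rewrite sB sB0 in ltB.
    by left.
  right; exists x => //; move: ltx; rewrite eB' big_cons !mnmDE; lia.
case: B okB ltB => [|[[p z] a] B] // okB _.
have [[b hb eb] byp] := okB _ (mem_head _ _).
rewrite big_nil; set R := (X in closes X).
have aR : (a <= R)%MM.
  by apply/mnm_lepP => j; rewrite /R /cost big_cons !mnmDE /=; lia.
rewrite big_nil /ends big_cons -/(ends B) /=.
have := me t; move: (e t) => [u w] /= et.
rewrite /= in eb byp.
have byR x : (m t x < (U_(p) + U_(z))%MM x)%N -> bypass R x ->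
  exists2 x0, ((m t + 0)%MM x0 < (U_(p) + U_(z) + ends B)%MM x0)%N & bypass R x0.
  by move=> ltx byx; exists x => //; move: ltx; rewrite !mnmDE mnm0E; lia.
(* The chord [x ... y] meets [t = x - q] at [x]: a cycle if [y = q], and a path
   from [y] to [q] otherwise. *)
have meet x y q : (U_(p) + U_(z) = U_(x) + U_(y) :> 'X_{1..n})%MM ->
    m t = (U_(x) + U_(q))%MM -> closes R \/
  exists2 x0, ((m t + 0)%MM x0 < (U_(p) + U_(z) + ends B)%MM x0)%N & bypass R x0.
  move=> epz etx; have [eyq|neyq] := eqVneq y q.
    left; exists a, b; split=> //; rewrite eb etx -eyq -epz.
    by apply/mnmP => v; rewrite !mnmDE; lia.
  right; apply: (byR y).
    by by rewrite epz etx !mnmDE !mnm1E eqxx [q == y]eq_sym (negPf neyq); lia.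
  exists a, b, q; split=> //; rewrite eb etx; apply/mnmP => v.
  by move/mnmP: epz => /(_ v); rewrite !mnmDE; lia.
have addC (x y : 'I_n) : (U_(x) + U_(y) = U_(y) + U_(x) :> 'X_{1..n})%MM.
  by apply/mnmP => v; rewrite !mnmDE addnC.
have [epu|nepu] := eqVneq p u; first by apply: (meet p z w); rewrite // et epu.
have [epw|nepw] := eqVneq p w.
  by apply: (meet p z u); rewrite // et epw addC.
have [ezu|nezu] := eqVneq z u; first by apply: (meet z p w); rewrite ?et ?ezu.
have [ezw|nezw] := eqVneq z w.
  by apply: (meet z p u); rewrite // et ezw addC.
right; case: byp => [byp|byz].
  apply: (byR p); last exact: bypass_le byp.
  by rewrite et !mnmDE !mnm1E eqxx ![_ == p]eq_sym (negPf nepu) (negPf nepw).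
apply: (byR z); last exact: bypass_le byz.
by rewrite et !mnmDE !mnm1E eqxx ![_ == z]eq_sym (negPf nezu) (negPf nezw) addn1.
Qed.

End Exchange.

(** * Exponent vectors and the order of formal products *)

Lemma mnm_letters r (a : 'X_{1..r}) :
  exists2 s : seq 'I_r, a = (\sum_(i <- s) U_(i))%MM & size s = mdeg a.
Proof.
move: {2}(mdeg a) (erefl (mdeg a)) => d; elim: d a => [|d IH] a da.
  by exists [::]; rewrite ?da // big_nil; apply/eqP; rewrite -mdeg_eq0 da.
have [i ai] : exists i, (0 < a i)%N.
  apply/existsP; apply: contra_eqT da => /existsPn a0.
  by rewrite mdegE big1 // => i _; move: (a0 i); case: (a i).
have ea : a = (U_(i) + (a - U_(i)))%MM.
  by apply/mnmP => j; rewrite mnmDE mnmBE mnm1E; case: (eqVneq i j) ai => [->|]; lia.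
have dB : mdeg (a - U_(i))%MM = d by move: da; rewrite {1}ea mdegD mdeg1 add1n => -[].
have [s es ss] := IH _ dB.
by exists (i :: s); rewrite /= ?ss ?dB ?da // big_cons -es.
Qed.

Lemma mdeg2P n (u : 'X_{1..n}) :
  mdeg u = 2%N -> exists e : 'I_n * 'I_n, u = (U_(e.1) + U_(e.2))%MM.
Proof.
have [s es <-] := mnm_letters u; rewrite {u}es.
case: s => [|p [|q [|]]] // _; exists (p, q).
by apply/mnmP => v; rewrite !big_cons big_nil !mnmDE mnm0E addn0.
Qed.

Section Precedes.
Variable r : nat.
Implicit Types a b c : 'X_{1..r}.

Lemma precedesP a b :
  reflect (exists2 i : 'I_r, (forall j : 'I_r, (i < j)%N -> a j = b j) & (a i < b i)%N)
          (precedes a b).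
Proof.
apply: (iffP existsP) => -[i].
  by case/andP => /forallP h lt; exists i => // j ij; apply/eqP/(implyP (h j)).
by move=> h lt; exists i; rewrite lt andbT; apply/forallP => j; apply/implyP => /h ->.
Qed.

Lemma precedes_irr : irreflexive (@precedes r).
Proof. by move=> a; apply/precedesP => -[i _]; rewrite ltnn. Qed.

Lemma precedes_trans : transitive (@precedes r).
Proof.
move=> b a c /precedesP[i hi lti] /precedesP[j hj ltj]; apply/precedesP.
have [ij|ji|eij] := ltngtP i j.
- exists j => [l jl|]; first by rewrite hi ?hj //; apply: ltn_trans jl.
  by rewrite hi.
- exists i => [l il|]; first by rewrite hi ?hj //; apply: ltn_trans il.
  by rewrite -hj.
have {}eij : i = j by apply: val_inj.
subst j; exists i => [l il|]; first by rewrite hi ?hj.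
exact: ltn_trans ltj.
Qed.

Lemma precedes_neq_total a b : a != b -> precedes a b || precedes b a.
Proof.
move=> ne_ab.
have [i0 ne0] : exists i, a i != b i.
  apply/existsP; apply: contraNT ne_ab => /existsPn h.
  by apply/eqP/mnmP => i; apply/eqP/negPn/h.
case: (arg_maxnP (fun i : 'I_r => val i) (P := [pred i | a i != b i]) (i0 := i0) ne0).
move=> i /= ne_i max_i.
have same (j : 'I_r) : (i < j)%N -> a j = b j.
  by move=> ij; apply/eqP; apply: contraTT ij => /max_i; rewrite -leqNgt.
have [lt|gt|eq] := ltngtP (a i) (b i); last by rewrite eq eqxx in ne_i.
  by apply/orP; left; apply/precedesP; exists i.
by apply/orP; right; apply/precedesP; exists i => // j /same.
Qed.

End Precedes.

(** * The exchange property of formal products *)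

Section Linear.
Variables (n r : nat) (m : 'I_r -> 'X_{1..n}).
Hypothesis m2 : forall i, mdeg (m i) = 2%N.

Lemma mval_sum (s : seq 'I_r) : mval m (\sum_(i <- s) U_(i))%MM = (\sum_(i <- s) m i)%MM.
Proof.
elim: s => [|i s IH]; first by rewrite !big_nil mval0.
by rewrite !big_cons mvalD mval1 IH.
Qed.

Lemma mdeg_mval a : mdeg (mval m a) = (2 * mdeg a)%N.
Proof.
rewrite /mval mdeg_sum mdegE big_distrr /=; apply: eq_bigr => i _.
by rewrite mdegMn m2.
Qed.

Lemma precedes_swap (t : 'I_r) (a al be : 'X_{1..r}) :
    below t be -> (U_(t) + al <= a)%MM -> (forall j : 'I_r, (t < j)%N -> al j = 0%N) ->
  precedes (a - (U_(t) + al) + be)%MM a.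
Proof.
move=> bbe le_a al0; apply/precedesP; exists t => [j tj|].
  rewrite mnmDE mnmBE mnmDE mnm1E bbe ?(ltnW tj) // al0 //.
  by rewrite -[t == j]val_eqE /= (ltn_eqF tj) subn0 addn0.
rewrite mnmDE mnmBE mnmDE mnm1E bbe // eqxx.
by move/mnm_lepP: le_a => /(_ t); rewrite mnmDE mnm1E eqxx; lia.
Qed.

Hypothesis lqm : forall i j : 'I_r, (i < j)%N ->
  exists p (l : 'I_r), [/\ (l < j)%N, (m j p < m i p)%N & (m l <= m j + U_(p))%MM].

(** The linear quotient property enters only here: it gives an edge [l] below
    [t] that divides [m t * x_x] for an end [x] of the edge [i], and exchanging
    [t] for [l] gains exactly that vertex. *)
Lemma chord_generator (t i : 'I_r) (p : 'I_n * 'I_n) :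
  m i = (U_(p.1) + U_(p.2))%MM -> (i < t)%N -> chord_ok m t (p, 0%MM).
Proof.
have below1 (l : 'I_r) : (l < t)%N -> below t U_(l).
  by move=> lt j tj; rewrite mnm1E -val_eqE /= ltn_eqF // (leq_trans lt).
move=> ei lt_it; split => /=.
  exists U_(i)%MM; first exact: below1.
  by rewrite mval1 mval0 ei; apply/mnmP => v; rewrite !mnmDE mnm0E.
have [x [l [lt_lt ltx le_l]]] := lqm lt_it.
have [q eq] : exists q, (m l + U_(q) = m t + mval m 0 + U_(x))%MM.
  have /mdeg1P[q /eqP eq] : mdeg (m t + U_(x) - m l)%MM == 1%N.
    by have := congr1 (@mdeg n) (submK le_l); rewrite !mdegD !m2 mdeg1; lia.
  exists q; rewrite -eq addmC submK // mval0.
  by apply/mnmP => v; rewrite !mnmDE mnm0E; lia.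
have byx : bypass m t 0%MM x.
  exists 0%MM, U_(l)%MM, q; split; [exact: lepm_refl | exact: below1 |].
  by rewrite mval1.
move: ltx; rewrite ei mnmDE !mnm1E.
case: (eqVneq p.1 x) => [->|_]; first by left.
by case: (eqVneq p.2 x) => [->|_]; [right | lia].
Qed.

(** The combinatorial core of the theorem: [exchange] is applied to what remains
    of [a] and [b] after removal of their common part [d]. *)
Lemma product_exchange (a b : 'X_{1..r}) :
    mdeg a = mdeg b -> precedes b a ->
    (forall c, mdeg c = mdeg a -> precedes c a -> mval m c != mval m a) ->
  exists c x, [/\ mdeg c = mdeg a, precedes c a, (mval m a x < mval m b x)%N
    & (mval m c <= mval m a + U_(x))%MM].
Proof.
move=> dab /precedesP[t eq_ab lt_t] rep_a.
have [e me] := fin_all_exists (fun i => mdeg2P (m2 i)).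
pose d : 'X_{1..r} := [multinom minn (a i) (b i) | i < r].
have da : a = (d + (a - d))%MM by apply/mnmP => i; rewrite mnmDE mnmBE mnmE; lia.
have db : b = (d + (b - d))%MM by apply/mnmP => i; rewrite mnmDE mnmBE mnmE; lia.
pose R := (a - d - U_(t))%MM.
have dR : (a - d = U_(t) + R)%MM.
  apply/mnmP => i; rewrite mnmDE /R !mnmBE mnmE mnm1E.
  by case: (eqVneq t i) lt_t => [->|]; lia.
have [s es ss] := mnm_letters R.
have [sb esb ssb] := mnm_letters (b - d)%MM.
(* Above [t] the vectors agree and at [t] the entry of [b] is the smaller one,
   so whatever survives in [b - d] lies strictly below [t]. *)
have lt_sb i : i \in sb -> (i < t)%N.
  move=> isb; have : (0 < (b - d)%MM i)%N.
    by rewrite esb mnm_sumE (big_rem i) //= mnm1E eqxx.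
  rewrite mnmBE mnmE; have [//|ti|/val_inj ->] := ltngtP i t; last by lia.
  by rewrite eq_ab // minnn subnn.
(* Each remaining factor of [b] is an honest blue edge: no red edge inside. *)
pose B : seq (chord n r) := [seq (e i, 0%MM) | i <- sb].
have okB : {in B, forall f, chord_ok m t f}.
  by move=> f /mapP[i /lt_sb lt_it ->]; apply: chord_generator (me i) lt_it.
have costB : cost B = 0%MM by rewrite /cost big_map big1_eq.
have endsB : ends B = mval m (b - d)%MM.
  by rewrite esb mval_sum /ends big_map; apply: eq_bigr => i _; rewrite me.
have ltB : (size s < size B)%N.
  rewrite size_map ss ssb.
  have := congr1 (@mdeg r) da; have := congr1 (@mdeg r) db.
  by rewrite dR !mdegD mdeg1; lia.
(* The exchange itself, with the value kept free of subtractions. *)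
have swap al be : (al <= R)%MM -> below t be ->
    mdeg (mval m be) = mdeg (m t + mval m al)%MM ->
  let c := (a - (U_(t) + al) + be)%MM in
  [/\ mdeg c = mdeg a, precedes c a
    & (mval m c + (m t + mval m al) = mval m a + mval m be)%MM].
  move=> alR bbe dbe c.
  have le_a : (U_(t) + al <= a)%MM.
    by apply/mnm_lepP => j; rewrite da dR !mnmDE; move/mnm_lepP: alR => /(_ j); lia.
  have ea : (c + (U_(t) + al) = a + be)%MM.
    rewrite /c -{2}(submK le_a); apply/mnmP => j; rewrite !mnmDE; lia.
  split.
  - move: (congr1 (@mdeg r) ea) dbe; rewrite !mdegD !mdeg_mval m2 mdeg1; lia.
  - apply: precedes_swap => // j tj.
    move/mnm_lepP: alR => /(_ j); rewrite /R !mnmBE mnmE eq_ab // minnn; lia.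
  - by rewrite -(mval1 m t) -!mvalD ea.
have := exchange me okB ltB; rewrite costB add0m -es.
case=> [[al [be [alR bbe ebe]]] | [x ltx [al [be [q [alR bbe ebe]]]]]].
  have [dc pc ec] := swap _ _ alR bbe (congr1 (@mdeg n) ebe).
  move: (rep_a _ dc pc); rewrite -(eqm_add2r (m t + mval m al)) ec ebe eqxx //.
have dbe : mdeg (mval m be) = mdeg (m t + mval m al)%MM.
  by move: (congr1 (@mdeg n) ebe); rewrite !mdegD !mdeg1; lia.
have [dc pc ec] := swap _ _ alR bbe dbe.
exists (a - (U_(t) + al) + be)%MM, x; split => //.
  rewrite da db dR !mvalD mval1 !mnmDE.
  by move: ltx; rewrite endsB es mval_sum mnmDE; lia.
apply/mnm_lepP => v; move/mnmP: ec => /(_ v); move/mnmP: ebe => /(_ v).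
by rewrite !mnmDE; lia.
Qed.

End Linear.

(** * Monomial ideals *)

Import GRing.Theory.

Section MonomialIdeals.
Variables (K : fieldType) (n : nat).
Local Notation P := {mpoly K[n]}.
Local Open Scope ring_scope.
Implicit Types (S : 'X_{1..n} -> Prop) (s : seq 'X_{1..n}) (I J : P -> Prop).

(** Membership in the ideal generated by the monomials with exponents in [S]
    ([ideal_gen_monomials]), as a condition on the support: it is what makes
    sums, products and colon ideals computable monomial by monomial. *)
Definition divided_by S (p : P) : Prop :=
  forall w, w \in msupp p -> exists2 u, S u & (u <= w)%MM.

Local Notation monos s := [seq ('X_[u] : P) | u <- s].

Lemma ideal_gen_ext (R : comNzRingType) (G H : R -> Prop) :
  same_set G H -> same_set (ideal_gen G) (ideal_gen H).
Proof.
by move=> GH p; split=> -[c [hc ->]]; exists c; split=> // x /hc /GH.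
Qed.

Lemma lepm_add k (u v w x : 'X_{1..k}) :
  (u <= v -> w <= x -> u + w <= v + x)%MM.
Proof.
move=> /mnm_lepP uv /mnm_lepP wx; apply/mnm_lepP => i.
by rewrite !mnmDE leq_add.
Qed.

Lemma same_set_trans (T : Type) (A B C : T -> Prop) :
  same_set A B -> same_set B C -> same_set A C.
Proof. by move=> AB BC x; split=> [/AB/BC|/BC/AB]. Qed.

Lemma divided_byD S p q : divided_by S p -> divided_by S q -> divided_by S (p + q).
Proof. by move=> hp hq w /msuppD_le; rewrite mem_cat => /orP[/hp|/hq]. Qed.

Lemma divided_by0 S : divided_by S 0.
Proof. by move=> w; rewrite msupp0. Qed.

Lemma divided_by_mul S T U p q :
    (forall u v, S u -> T v -> exists2 w, U w & (w <= u + v)%MM) ->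
  divided_by S p -> divided_by T q -> divided_by U (p * q).
Proof.
move=> STU hp hq w /msuppM_le /allpairsP[[w1 w2] /= [/hp [u Su u1] /hq [v Tv v2] ->]].
have [x Ux xle] := STU _ _ Su Tv; exists x => //; apply: lepm_trans xle _.
exact: lepm_add.
Qed.

Lemma divided_byX S u : divided_by S 'X_[u] <-> exists2 v, S v & (v <= u)%MM.
Proof.
split=> [h|h w]; first by apply: h; rewrite msuppX mem_head.
by rewrite msuppX inE => /eqP ->.
Qed.

Lemma ideal_gen_monomials S :
  same_set (ideal_gen (fun p : P => exists2 u, S u & p = 'X_[u])) (divided_by S).
Proof.
move=> p; split=> [[c [hc ->]]|hp].
  elim: c hc => [|x c IH] hc; first by rewrite big_nil; apply: divided_by0.
  rewrite big_cons; apply: divided_byD; last first.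
    by apply: IH => y yc; apply: hc; rewrite inE yc orbT.
  have [u Su ->] := hc x (mem_head _ _).
  apply: (@divided_by_mul (fun _ => True) S) => [v w _ Sw|w _|].
  - by exists w => //; rewrite lem_addl.
  - by exists w => //; apply: lepm_refl.
  - by apply/divided_byX; exists u => //; apply: lepm_refl.
suff gen (l : seq 'X_{1..n}) : {subset l <= msupp p} ->
    ideal_gen (fun q : P => exists2 u, S u & q = 'X_[u])
      (\sum_(w <- l) p@_w *: 'X_[w]).
  by rewrite (mpolyE p); apply: gen.
elim: l => [|w l IH] sub.
  by exists [::]; rewrite !big_nil; split.
have [|c [hc ec]] := IH; first by move=> v vl; apply: sub; rewrite inE vl orbT.
have [u Su le_uw] := hp w (sub _ (mem_head _ _)).
exists ((p@_w *: 'X_[w - u], 'X_[u]) :: c); split.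
  by move=> x; rewrite inE => /predU1P[-> /=|/hc //]; exists u.
by rewrite !big_cons ec /= -scalerAl -mpolyXD submK.
Qed.

Lemma ideal_seq_monomials s :
  same_set (ideal_seq (monos s)) (divided_by (fun u => u \in s)).
Proof.
apply: same_set_trans (ideal_gen_monomials _); apply: ideal_gen_ext => q.
split=> [/mapP[u us ->]|[u us ->]]; first by exists u.
exact: map_f.
Qed.

Lemma mpolyX_inj : injective (fun u : 'X_{1..n} => 'X_[u] : P).
Proof.
by move=> u v /(congr1 (@msupp _ _)); rewrite !msuppX => -[].
Qed.

(** A monomial lies in a monomial ideal only if a generator divides it, so
    minimality of a generating list of monomials is indivisibility. *)
Lemma minimal_monomial_generators I s :
  minimal_generators I (monos s) <->
  [/\ uniq s, same_set I (divided_by (fun u => u \in s))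
    & {in s &, forall u v, (u <= v)%MM -> u = v}].
Proof.
split=> [[us Is min]|[us Is anti]].
  split; first by move: us; rewrite (map_inj_uniq mpolyX_inj).
    by move=> p; split=> [/Is/ideal_seq_monomials|/ideal_seq_monomials/Is].
  move=> u v us_u vs le_uv; apply/eqP/negPn/negP => ne_uv.
  rewrite (map_inj_uniq mpolyX_inj) in us.
  have nX : 'X_[v] \notin monos (rem v s).
    by rewrite (mem_map mpolyX_inj) mem_rem_uniqF.
  apply: (negP nX); have vX : 'X_[v] \in monos s by apply: map_f.
  apply: (min (monos (rem v s)) _ _ _ vX) => [x /mapP[w /mem_rem ws ->]|p].
    exact: map_f.
  split=> [/Is/ideal_seq_monomials|/ideal_seq_monomials] hp.
    apply/ideal_seq_monomials => w /hp[x xs xw].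
    have [exv|nexv] := eqVneq x v.
      exists u; last by apply: lepm_trans xw; rewrite exv.
      by rewrite mem_rem_uniq // inE ne_uv.
    by exists x; rewrite ?mem_rem_uniq ?inE ?nexv.
  apply/Is/ideal_seq_monomials => w /hp[x xs xw].
  by exists x => //; apply: mem_rem xs.
split; first by rewrite (map_inj_uniq mpolyX_inj).
  by move=> p; split=> [/Is/ideal_seq_monomials|/ideal_seq_monomials/Is].
move=> t sub It p /mapP[u us_u ->{p}].
pose t' := [seq v <- s | 'X_[v] \in t].
have tt' : t =i monos t'.
  move=> x; apply/idP/mapP => [xt|[v]]; last by rewrite mem_filter => /andP[vt _ ->].
  have /mapP[v vs ex] := sub _ xt; exists v => //.
  by rewrite mem_filter -ex xt.
have : I 'X_[u] by apply/Is/divided_byX; exists u => //; apply: lepm_refl.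
move/It => h; have /ideal_seq_monomials/divided_byX[v] : ideal_seq (monos t') 'X_[u].
  by move: h; apply: (proj1 (ideal_gen_ext _ _)) => x; rewrite tt'.
rewrite mem_filter => /andP[vt vs] /(anti _ _ vs us_u) evu.
by rewrite -evu.
Qed.

Lemma colon_monomial s u :
  same_set (ideal_colon (ideal_seq (monos s)) (ideal_seq [:: 'X_[u] : P]))
           (divided_by (fun w => exists2 v, v \in s & (v <= w + u)%MM)).
Proof.
move=> f; split=> [h w wf|h g].
  have /h : ideal_seq [:: 'X_[u] : P] 'X_[u].
    exists [:: (1, 'X_[u])]; split; last by rewrite big_seq1 mul1r.
    by move=> x; rewrite inE => /eqP -> /=; rewrite mem_head.
  case/ideal_seq_monomials/(_ (u + w)%MM) => [|v vs le].
    by rewrite (perm_mem (msuppMX _ _)) map_f.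
  by exists w; [exists v; rewrite // addmC | apply: lepm_refl].
move=> /(ideal_seq_monomials [:: u]) hg; apply/ideal_seq_monomials.
apply: divided_by_mul h hg => w v [x xs xle]; rewrite inE => /eqP ->.
by exists x.
Qed.

(** For [S] closed under multiples, an ideal of variables containing [w] has to
    contain a variable that divides [w]; conversely the variables in [S] then
    generate. *)
Lemma generated_by_variablesP I (S : pred 'X_{1..n}) :
    same_set I (divided_by S) ->
    (forall u v, S u -> (u <= v)%MM -> S v) ->
  generated_by_variables I <->
  (forall w, S w -> exists2 p : 'I_n, (0 < w p)%N & S U_(p)%MM).
Proof.
move=> IS upS.
have genA (A : {set 'I_n}) :
    same_set (ideal_gen (fun p : P => exists2 j, j \in A & p = 'X_j))
             (divided_by (fun u => exists2 j, j \in A & u = U_(j)%MM)).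
  apply: same_set_trans (ideal_gen_monomials _); apply: ideal_gen_ext => q.
  by split=> [[j jA ->]|[_ [j jA ->] ->]]; [exists U_(j)%MM => //|]; exists j.
split=> [[A IA] w Sw|h].
  have : I 'X_[w] by apply/IS/divided_byX; exists w => //; apply: lepm_refl.
  case/IA/genA/divided_byX => _ [j jA ->]; rewrite lep1mP -lt0n => wj.
  exists j => //; have : I 'X_j.
    by apply/IA/genA/divided_byX; exists U_(j)%MM; [exists j | apply: lepm_refl].
  by case/IS/divided_byX => v Sv le_v; apply: upS le_v.
exists [set j | S U_(j)%MM] => f; split=> [/IS hf | /genA hf].
  apply/genA => w /hf[u Su le_u]; have [p wp Sp] := h _ (upS _ _ Su le_u).
  exists U_(p)%MM; last by rewrite lep1mP -lt0n.
  by exists p; rewrite ?inE.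
apply/IS => w /hf[_ [j + ->] le_j]; rewrite inE => Sj.
by exists U_(j)%MM.
Qed.

(** The colon ideal of the first [i] entries by the next one, [u], contains the
    quotient of each [v] by its common part with [u]; a variable dividing this
    quotient is one whose exponent is larger in [v] than in [u]. *)
Lemma linear_quotient_orderingP I s :
  linear_quotient_ordering I (monos s) <->
  [/\ uniq s, same_set I (divided_by (fun u => u \in s)),
      {in s &, forall u v, (u <= v)%MM -> u = v}
    & forall i, (0 < i < size s)%N -> forall v, v \in take i s ->
      exists p v', [/\ (nth 0%MM s i p < v p)%N, v' \in take i s
        & (v' <= nth 0%MM s i + U_(p))%MM]].
Proof.
have colonP i : (0 < i < size s)%N ->
    generated_by_variables
      (ideal_colon (ideal_seq (take i (monos s))) (ideal_seq [:: (monos s)`_i])) <->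
    (forall v, v \in take i s -> exists p v', [/\ (nth 0%MM s i p < v p)%N,
       v' \in take i s & (v' <= nth 0%MM s i + U_(p))%MM]).
  case/andP=> _ lt_i; rewrite -map_take (nth_map 0%MM) //.
  set u := nth _ s i; pose S w := has (fun v => (v <= w + u)%MM) (take i s).
  have IS : same_set (ideal_colon (ideal_seq (monos (take i s))) (ideal_seq [:: 'X_[u] : P]))
              (divided_by S).
    move=> f; split=> [/colon_monomial hf w /hf[x [v vs le_v] le_x]|hf].
      by exists x => //; apply/hasP; exists v.
    by apply/colon_monomial => w /hf[x /hasP[v vs le_v] le_x]; exists x => //; exists v.
  have upS x y : S x -> (x <= y)%MM -> S y.
    move=> /hasP[v vs le_v] le_xy; apply/hasP; exists v => //.
    by apply: lepm_trans le_v _; apply: lepm_add le_xy (lepm_refl _).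
  split=> [/(generated_by_variablesP IS upS) h v vs | h].
    (* Truncated subtraction: this is the quotient of [v] by [gcd (u, v)]. *)
    have [|p] := h (v - u)%MM.
      by apply/hasP; exists v => //; apply/mnm_lepP => q; rewrite mnmDE mnmBE; lia.
    rewrite mnmBE subn_gt0 => ltp /hasP[v' v's le_v'].
    by exists p, v'; split=> //; rewrite addmC.
  apply/(generated_by_variablesP IS upS) => w /hasP[v vs /mnm_lepP le_v].
  have [p [v' [ltp v's le_v']]] := h v vs.
  exists p; first by move: (le_v p) ltp; rewrite mnmDE; lia.
  by apply/hasP; exists v' => //; rewrite addmC.
split=> [[/minimal_monomial_generators[us Is anti] lq]|[us Is anti lq]].
  by split=> // i lt_i; apply/colonP => //; apply: lq; rewrite size_map.
split; first exact/minimal_monomial_generators.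
by move=> i; rewrite size_map => lt_i; apply/(colonP i lt_i)/lq.
Qed.

End MonomialIdeals.

(** * Representatives and powers *)

Section Sorting.
Variables (R : comNzRingType) (r : nat) (g : 'I_r -> R) (k : nat).
Local Notation fp := (formal_products r k).

Lemma mem_formal_products (a : 'X_{1..r}) : (a \in fp) = (mdeg a == k).
Proof.
rewrite mem_sort mem_filter andb_idr // => /eqP dk.
have dk1 : (mdeg a < k.+1)%N by rewrite dk.
by apply/mapP; exists (BMultinom dk1); rewrite ?mem_enum.
Qed.

Lemma sorted_formal_products : sorted (@precedes r) fp.
Proof.
have uniq_fp : uniq fp.
  by rewrite sort_uniq filter_uniq // map_inj_uniq ?enum_uniq //; apply: val_inj.
pose le (a b : 'X_{1..r}) := (a == b) || precedes a b.
have le_total : total le.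
  move=> a b; rewrite /le; have [->|/precedes_neq_total/orP[]->] := eqVneq a b => //.
  by rewrite !orbT.
have le_trans : transitive le.
  move=> b a c /orP[/eqP->//|ab] /orP[/eqP<-|bc]; rewrite /le ?ab ?orbT //.
  by rewrite (precedes_trans ab bc) orbT.
apply: pairwise_sorted.
have : pairwise [rel x y | (x != y) && le x y] fp.
  by rewrite pairwise_relI -uniq_pairwise uniq_fp -sorted_pairwise ?sort_sorted.
by apply: sub_pairwise => a b /= /andP[/negPf]; rewrite /le => ->.
Qed.

Local Notation reps := [seq a <- fp | representative g k a].

Lemma sorted_reps : sorted (@precedes r) reps.
Proof. exact/sorted_filter/sorted_formal_products/precedes_trans. Qed.

(** The list is an ordering in the strict sense, so its initial segments are
    the sets of predecessors. *)
Lemma precedes_index (s : seq 'X_{1..r}) a b :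
    sorted (@precedes r) s -> a \in s -> b \in s ->
  precedes a b = (index a s < index b s)%N.
Proof.
move=> sorted_s a_s b_s; apply/idP/idP => [ab|]; last first.
  by apply: (sorted_ltn_index (@precedes_trans r) sorted_s).
rewrite ltnNge leq_eqVlt; apply/negP => /orP[/eqP eba|lt_ba].
  have eab : a = b by rewrite -(nth_index a a_s) -eba nth_index.
  by rewrite eab precedes_irr in ab.
have ba : precedes b a by apply: (sorted_ltn_index (@precedes_trans r) sorted_s).
by have := precedes_trans ab ba; rewrite precedes_irr.
Qed.

Lemma representative_neq a b :
    mdeg b = k -> representative g k a -> precedes b a ->
  product_value g b != product_value g a.
Proof.
move=> db /allP/(_ b); rewrite mem_formal_products db eqxx => /(_ isT).
by move/implyP.
Qed.

(** Replacing a formal product by an earlier one of the same value ends at a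
    representative, so deleting repetitions loses no value and no predecessor. *)
Lemma representative_exists a : mdeg a = k ->
  exists2 c, c \in reps &
    product_value g c = product_value g a /\ (c = a \/ precedes c a).
Proof.
move=> da; have : a \in fp by rewrite mem_formal_products da.
move: {2}(index a fp).+1 (ltnSn (index a fp)) => N; elim: N a {da} => // N IH a.
rewrite ltnS => le_N a_fp; have [rep_a|] := boolP (representative g k a).
  by exists a; [rewrite mem_filter rep_a | split=> //; left].
case/allPn => b b_fp; rewrite negb_imply negbK => /andP[ba /eqP eq_ba].
have [||c c_reps [eq_cb c_b]] := IH b; last 1 first.
- exists c => //; split; first by rewrite eq_cb.
  by right; case: c_b => [->//|cb]; apply: precedes_trans ba.
- apply: leq_trans le_N; rewrite -precedes_index //; exact: sorted_formal_products.
- by [].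
Qed.

End Sorting.

Section Powers.
Variables (K : fieldType) (n r : nat) (m : 'I_r -> 'X_{1..n}).
Local Notation P := {mpoly K[n]}.
Local Open Scope ring_scope.
Local Notation g := (fun i : 'I_r => 'X_[m i] : P).

Lemma mpolyX_sum (J : Type) (s : seq J) (F : J -> 'X_{1..n}) :
  'X_[\sum_(j <- s) F j] = \prod_(j <- s) 'X_[F j] :> P.
Proof. exact: (big_morph (fun u => 'X_[u] : P) (@mpolyXD _ _) (@mpolyX0 _ _)). Qed.

Lemma product_valueX a : product_value g a = 'X_[mval m a].
Proof.
rewrite /product_value /mval mpolyX_sum; apply: eq_bigr => i _.
by rewrite mpolyXn.
Qed.

(** A product of [k] arbitrary elements of the ideal has all its monomials
    divisible by products of [k] generators, because supports multiply. *)
Lemma ideal_pow_monomials (I : P -> Prop) k :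
    same_set I (divided_by (fun u => exists i, u = m i)) ->
  same_set (ideal_pow I k)
    (divided_by (fun u => exists2 a, mdeg a = k & u = mval m a)).
Proof.
move=> Im; pose S d u := exists2 a, mdeg a = d & u = mval m a.
have prodS d (f : 'I_d -> P) : (forall i, I (f i)) -> divided_by (S d) (\prod_(i < d) f i).
  elim: d f => [|d IH] f If.
    rewrite big_ord0 -mpolyX0; apply/divided_byX; exists 0%MM; last exact: lepm_refl.
    by exists 0%MM; rewrite ?mdeg0 ?mval0.
  rewrite big_ord_recl.
  apply: divided_by_mul (IH _ (fun i => If (lift ord0 i))); last exact/Im/If.
  move=> _ _ [i ->] [a da ->]; exists (m i + mval m a)%MM; last exact: lepm_refl.
  by exists (U_(i) + a)%MM; rewrite ?mdegD ?mdeg1 ?da // mvalD mval1.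
move=> p; split=> [[c [hc ->]]|].
  elim: c hc => [|x c IH] hc; first by rewrite big_nil; apply: divided_by0.
  rewrite big_cons; apply: divided_byD; last first.
    by apply: IH => y yc; apply: hc; rewrite inE yc orbT.
  have [f [If ->]] := hc x (mem_head _ _).
  apply: (@divided_by_mul _ _ (fun _ => True) (S k)) (prodS _ _ If) => [v w _ Sw|w _].
    by exists w => //; rewrite lem_addl.
  by exists w => //; apply: lepm_refl.
case/ideal_gen_monomials => c [hc ->]; exists c; split=> // x /hc[_ [a da ->] ->].
have [s es ss] := mnm_letters a; move: ss; rewrite da => ss; case: k / ss {da hc} => //.
exists (fun i => 'X_[m (tnth (in_tuple s) i)]); split=> [i|].
  apply/Im/divided_byX; exists (m (tnth (in_tuple s) i)); last exact: lepm_refl.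
  by exists (tnth (in_tuple s) i).
by rewrite es mval_sum mpolyX_sum big_tnth.
Qed.

End Powers.

(** * The generators and the theorem *)

Lemma lepm_mdeg_eq n (u v : 'X_{1..n}) : (u <= v)%MM -> mdeg u = mdeg v -> u = v.
Proof.
move=> le_uv duv; have := congr1 (@mdeg n) (submK le_uv).
rewrite mdegD duv => /eqP; rewrite -{2}[mdeg v]add0n eqn_add2r mdeg_eq0 => /eqP e0.
by rewrite -(submK le_uv) e0 add0m.
Qed.

Section Generators.
Local Open Scope ring_scope.
Variables (K : fieldType) (n r : nat) (m : 'I_r -> 'X_{1..n}).
Variable I : {mpoly K[n]} -> Prop.
Hypothesis hI : quadratic_monomial_ideal I.
Hypothesis hm : linear_quotient_ordering I
  [seq ('X_[m i] : {mpoly K[n]}) | i <- enum 'I_r].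

Let ms := [seq m i | i <- enum 'I_r].

Let hms : linear_quotient_ordering I [seq ('X_[u] : {mpoly K[n]}) | u <- ms].
Proof. by rewrite -map_comp. Qed.

Lemma mem_generators u : u \in ms <-> exists i, u = m i.
Proof.
split=> [/mapP[i _ ->]|[i ->]]; first by exists i.
by rewrite map_f // mem_enum.
Qed.

Lemma ideal_generators : same_set I (divided_by (fun u => exists i, u = m i)).
Proof.
have [_ Is _ _] := (linear_quotient_orderingP _ _).1 hms.
move=> p; split=> [/Is|] hp; last apply/Is.
  by move=> w /hp[u /mem_generators us le_u]; exists u.
by move=> w /hp[u us le_u]; exists u => //; apply/mem_generators.
Qed.

(** The degree is known for some monomial generating set of the ideal; each
    minimal generator belongs to every such set. *)
Lemma generator_degree i : mdeg (m i) = 2%N.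
Proof.
have [_ _ anti _] := (linear_quotient_orderingP _ _).1 hms.
have [T [T2 IT]] := hI.
have I_T := same_set_trans IT (@ideal_gen_monomials K n T).
have /I_T/divided_byX[u Tu le_u] : I 'X_[m i].
  by apply/ideal_generators/divided_byX; exists (m i); [exists i | apply: lepm_refl].
have /ideal_generators/divided_byX[_ [j ->] le_j] : I 'X_[u].
  by apply/I_T/divided_byX; exists u => //; apply: lepm_refl.
have eji : m j = m i.
  apply: anti; last exact: lepm_trans le_u.
  - by apply/mem_generators; exists j.
  - by apply/mem_generators; exists i.
rewrite -(T2 _ Tu); congr mdeg; apply/mnmP => v.
move/mnm_lepP: le_u => /(_ v); move/mnm_lepP: le_j => /(_ v); rewrite eji; lia.
Qed.

Lemma generator_quotients (i j : 'I_r) : (i < j)%N ->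
  exists p (l : 'I_r), [/\ (l < j)%N, (m j p < m i p)%N & (m l <= m j + U_(p))%MM].
Proof.
move=> lt_ij; have [_ _ _ lq] := (linear_quotient_orderingP _ _).1 hms.
have take_ms u : u \in take j ms -> exists2 l : 'I_r, (l < j)%N & u = m l.
  rewrite -map_take => /mapP[l lj ->]; exists l => //.
  by move: lj; rewrite in_take ?mem_enum // index_enum_ord.
have nth_ms : nth 0%MM ms j = m j.
  by rewrite (nth_map j) ?size_enum_ord // nth_ord_enum.
have [||p [v [ltp v_in le_l]]] := lq j _ (m i).
- by rewrite size_map size_enum_ord ltn_ord (leq_ltn_trans _ lt_ij).
- by rewrite -map_take map_f // in_take ?mem_enum // index_enum_ord.
by have [l lt_l ev] := take_ms _ v_in; exists p, l; rewrite -nth_ms -ev.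
Qed.

End Generators.

Local Open Scope ring_scope.

Theorem theorem3p11 (K : fieldType) (n : nat) (I : {mpoly K[n]} -> Prop)
    (hI : quadratic_monomial_ideal I)
    (r : nat) (m : 'I_r -> 'X_{1..n})
    (hm : linear_quotient_ordering I
            [seq ('X_[m i] : {mpoly K[n]}) | i <- enum 'I_r])
    (k : nat) (hk : (1 <= k)%N) :
  linear_quotient_ordering (ideal_pow I k)
    (reduced_products (fun i : 'I_r => 'X_[m i] : {mpoly K[n]}) k).
Proof.
have m2 := generator_degree hI hm; have lqm := generator_quotients hm.
set g := fun i : 'I_r => _.
set F := [seq a <- formal_products r k | representative g k a].
have -> : reduced_products g k = [seq 'X_[u] | u <- [seq mval m a | a <- F]].
  by rewrite -map_comp; apply: eq_map => a; rewrite /= product_valueX.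
have inF a : a \in F -> mdeg a = k /\ representative g k a.
  by rewrite mem_filter mem_formal_products => /andP[-> /eqP].
have neq_val a c : a \in F -> mdeg c = k -> precedes c a -> mval m c != mval m a.
  move=> /inF[_ rep_a] dc /(representative_neq dc rep_a).
  by rewrite !product_valueX (inj_eq (@mpolyX_inj K n)).
have toF a : mdeg a = k -> exists2 c, c \in F &
    mval m c = mval m a /\ (c = a \/ precedes c a).
  move=> da; have [c cF []] := representative_exists g da.
  by rewrite !product_valueX => /(@mpolyX_inj K n) eq_ca h; exists c.
have srtF : sorted (@precedes r) F by apply: sorted_reps.
apply/linear_quotient_orderingP; split.
- rewrite map_inj_in_uniq; last first.
    move=> a b aF bF eq_ab; apply/eqP/negPn/negP => /precedes_neq_total/orP[ab|ba].
      by have := neq_val b a bF (inF a aF).1 ab; rewrite eq_ab eqxx.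
    by have := neq_val a b aF (inF b bF).1 ba; rewrite eq_ab eqxx.
  exact: (sorted_uniq (@precedes_trans r) (@precedes_irr r)).
- apply: same_set_trans (ideal_pow_monomials k (ideal_generators hm)) _ => p.
  split=> hp w /hp[u].
    case=> a /toF[c cF [<- _]] -> le_u; exists (mval m c) => //; exact: map_f.
  by case/mapP => a /inF[da _] -> le_u; exists (mval m a) => //; exists a.
- move=> _ _ /mapP[a /inF[da _] ->] /mapP[b /inF[db _] ->] le_ab.
  by apply: lepm_mdeg_eq le_ab _; rewrite !mdeg_mval // da db.
move=> i; rewrite size_map => /andP[_ lt_i] v; rewrite -map_take => /mapP[b bi ->{v}].
set a := nth 0%MM F i; have aF : a \in F by apply: mem_nth.
have idx_a : index a F = i.
  by rewrite index_uniq //; apply: (sorted_uniq (@precedes_trans r) (@precedes_irr r)).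
have takeF c : c \in F -> (c \in take i F) = precedes c a.
  by move=> cF; rewrite in_take // (precedes_index srtF) // idx_a.
have bF := mem_take bi; rewrite takeF // in bi.
have [da db] := ((inF a aF).1, (inF b bF).1).
have [||c [x [dc ca ltx le_c]]] := product_exchange m2 lqm _ bi.
- by rewrite da.
- by move=> c; rewrite da => dc; apply: neq_val.
have [c' c'F [eq_c' c'c]] := toF c (etrans dc da).
rewrite (nth_map 0%MM) // -/a; exists x, (mval m c'); split=> //; last by rewrite eq_c'.
rewrite map_f // takeF //; case: c'c => [->//|c'c]; exact: precedes_trans ca.
Qed.
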